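(* Let $Y\subset\mathbb{P}^5$ be a cubic fourfold having a singularity that deforms to $\widetilde{E}_6$. Then $Y$ is of type S6. In particular, $Y$ is not stable.
   Context: We work over $\mathbb{C}$. A cubic fourfold is a hypersurface in $\mathbb{P}^5$ given by a nonzero cubic form in $x_0,\dots,x_5$. Stability (meaning proper stability) is in the GIT sense for $\mathrm{SL}(6)$ acting on $\mathbb{P}(\mathrm{Sym}^3W)$, $W=H^0(\mathbb{P}^5,\mathcal{O}(1))$. $Y$ is of type S6 if in suitable linear coordinates its equation is a linear combination of cubic monomials $x_0^{i_0}\cdots x_5^{i_5}$ of weight $\sum i_ja_j\le0$, where $(a_0,\dots,a_5)=(2,0,0,0,-1,-1)$; equivalently it has the form $x_0q(x_4,x_5)+f(x_1,\dots,x_5)$. $\widetilde{E}_6$ is the class of germs in $(\mathbb{C}^5,0)$ given by $y_1^3+y_2^3+y_3^3+ay_1y_2y_3+y_4^2+y_5^2=0$, $a^3+27\neq0$. A singularity deforms to $\widetilde{E}_6$ if there are arbitrarily small deformations of the germ having, arbitrarily near the original point, a singular point of class $\widetilde{E}_6$ (including the case where the germ itself is of that class). *)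

(* Defs.v *)
From HB Require Import structures.
From mathcomp Require Import all_boot all_order all_algebra.
From mathcomp Require Import complex.
From mathcomp Require Import mpoly.
From mathcomp Require Import boolp classical_sets cardinality reals topology.
From mathcomp Require Import normedtype sequences.

Set Implicit Arguments.
Unset Strict Implicit.
Unset Printing Implicit Defensive.

Import Order.TTheory GRing.Theory Num.Theory numFieldNormedType.Exports.

Local Open Scope classical_set_scope.
Local Open Scope ring_scope.

(* All definitions are over a field [C] that is instantiated with the complex
   numbers [R[i]], [R : realType], in the theorem; an abstract numFieldType
   carries the topology of its norm, which [R[i]] itself does not get
   canonically. *)

Section AnalyticGerms.
Variable C : numFieldType.

(* [f] is the sum of a convergent power series on a polydisc centred at [p];
   the bound on the coefficients (Abel's condition) gives absolute convergence
   on the open polydisc of polyradius (r, ..., r). Here [0 < r] in [C] forces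
   [r] to be real. *)
Definition analytic_at n (f : 'rV[C]_n -> C) (p : 'rV[C]_n) : Prop :=
  exists (c : 'X_{1..n} -> C) (r M : C),
    [/\ 0 < r,
        forall m : 'X_{1..n}, `|c m| * r ^+ mdeg m <= M
      & forall y : 'rV[C]_n, (forall i, `|y 0 i| < r) ->
          (fun N : nat =>
             \sum_(m : 'X_{1..n < N}) c m * \prod_(i < n) y 0 i ^+ m i)
            @ \oo --> f (p + y)].

Definition analytic_map_at n k (f : 'rV[C]_n -> 'rV[C]_k) (p : 'rV[C]_n) :=
  forall j, analytic_at (fun y => f y 0 j) p.

Definition local_biholomorphism n (phi : 'rV[C]_n -> 'rV[C]_n) : Prop :=
  exists psi : 'rV[C]_n -> 'rV[C]_n,
    [/\ phi 0 = 0 /\ psi 0 = 0,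
        analytic_map_at phi 0,
        analytic_map_at psi 0,
        \forall z \near (0 : 'rV[C]_n), psi (phi z) = z
      & \forall z \near (0 : 'rV[C]_n), phi (psi z) = z].

Definition E6t_form (a : C) (z : 'rV[C]_5) : C :=
  z 0 0 ^+ 3 + z 0 1 ^+ 3 + z 0 2 ^+ 3 + a * (z 0 0 * z 0 1 * z 0 2)
  + z 0 3 ^+ 2 + z 0 4 ^+ 2.

(* The hypersurface germ {h = 0} at the origin of C^5 is isomorphic to a germ
   in normal form: the equations agree up to a change of coordinates and
   multiplication by a unit. *)
Definition class_E6t (h : 'rV[C]_5 -> C) : Prop :=
  exists (a : C) (phi : 'rV[C]_5 -> 'rV[C]_5) (u : 'rV[C]_5 -> C),
    [/\ a ^+ 3 + 27 != 0,
        local_biholomorphism phi,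
        analytic_at u 0,
        u 0 != 0
      & \forall z \near (0 : 'rV[C]_5), h (phi z) = u z * E6t_form a z].

(* [G (row_mx y t)] is a deformation, with parameter t in (C^k, 0), of the germ
   {h = 0} at the origin of C^5; a deformation over a singular base in C^k
   extends to one of this form. *)
Definition deforms_to_E6t (h : 'rV[C]_5 -> C) : Prop :=
  exists (k : nat) (G : 'rV[C]_(5 + k) -> C),
    [/\ analytic_at G 0,
        \forall y \near (0 : 'rV[C]_5), G (row_mx y 0) = h y
      & forall e : C, 0 < e ->
          exists (y : 'rV[C]_5) (t : 'rV[C]_k),
            [/\ forall i, `|y 0 i| < e,
                forall i, `|t 0 i| < e
              & class_E6t (fun z => G (row_mx (y + z) t))]].

End AnalyticGerms.

Section CubicFourfolds.
Variable C : numFieldType.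

Definition is_cubic_fourfold (F : {mpoly C[6]}) : Prop :=
  F != 0 /\ F \is 3.-homog.

Definition singular_point (F : {mpoly C[6]}) (p : 'rV[C]_6) : Prop :=
  [/\ p != 0, F.@[p 0] = 0 & forall i, F^`M(i).@[p 0] = 0].

(* Equation of {F = 0} in the affine chart x_j = 1, with origin moved to [p]. *)
Definition local_equation (F : {mpoly C[6]}) (p : 'rV[C]_6) (j : 'I_6)
    (y : 'rV[C]_5) : C :=
  F.@[fun i => if unlift j i is Some k then p 0 i / p 0 j + y 0 k else 1].

Definition has_singularity_deforming_to_E6t (F : {mpoly C[6]}) : Prop :=
  exists (p : 'rV[C]_6) (j : 'I_6),
    [/\ singular_point F p, p 0 j != 0 & deforms_to_E6t (local_equation F p j)].

(* F(g x) *)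
Definition lin_subst (g : 'M[C]_6) (F : {mpoly C[6]}) : {mpoly C[6]} :=
  F \mPo [tuple \sum_(j < 6) g i j *: 'X_j | i < 6].

Definition S6_weights : seq int := [:: 2; 0; 0; 0; -1; -1].

Definition type_S6 (F : {mpoly C[6]}) : Prop :=
  exists2 g : 'M[C]_6, g \in unitmx &
    forall m : 'X_{1..6}, m \in msupp (lin_subst g F) ->
      \sum_(i < 6) (m i)%:Z * S6_weights`_i <= 0.

(* The monomial coordinates on the space Sym^3 W of cubic forms; polynomial
   functions on Sym^3 W are elements of {mpoly C[cubic_dim]}. *)
Definition cubic_monomial : finType := {m : 'X_{1..6 < 4} | mdeg m == 3%N}.

Definition cubic_dim : nat := #|cubic_monomial|.

Definition cubic_coord (F : {mpoly C[6]}) (i : 'I_cubic_dim) : C :=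
  F@_(val (val (enum_val i : cubic_monomial))).

(* The orbit of the point [F] of P(Sym^3 W) under SL(6), as a cone. *)
Definition SL_orbit (F : {mpoly C[6]}) : set {mpoly C[6]} :=
  [set G | exists (g : 'M[C]_6) (c : C),
             [/\ \det g = 1, c != 0 & G = c *: lin_subst g F]].

Definition SL_invariant (P : {mpoly C[cubic_dim]}) : Prop :=
  forall (g : 'M[C]_6) (F : {mpoly C[6]}), \det g = 1 -> F \is 3.-homog ->
    P.@[cubic_coord (lin_subst g F)] = P.@[cubic_coord F].

(* The orbit of [F] is Zariski closed in the open subset {P != 0} of
   P(Sym^3 W). *)
Definition SL_orbit_closed_in (P : {mpoly C[cubic_dim]}) (F : {mpoly C[6]}) :
    Prop :=
  forall H : {mpoly C[6]}, H \is 3.-homog -> P.@[cubic_coord H] != 0 ->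
    (forall (e : nat) (Q : {mpoly C[cubic_dim]}), Q \is e.-homog ->
       (forall G, SL_orbit F G -> Q.@[cubic_coord G] = 0) ->
       Q.@[cubic_coord H] = 0) ->
    SL_orbit F H.

Definition SL_stabilizer (F : {mpoly C[6]}) : set 'M[C]_6 :=
  [set g | \det g = 1 /\ exists c : C, lin_subst g F = c *: F].

(* Mumford's proper stability of the point [F] of P(Sym^3 W): some invariant
   section P of O(d), d > 0, does not vanish at F, SL(6) acts with closed orbits
   on {P != 0} (an affine open set), and the stabilizer of F has dimension 0. *)
Definition stable (F : {mpoly C[6]}) : Prop :=
  exists (d : nat) (P : {mpoly C[cubic_dim]}),
    [/\ [/\ (0 < d)%N, P \is d.-homog & SL_invariant P],
        P.@[cubic_coord F] != 0,
        forall G : {mpoly C[6]}, G \is 3.-homog -> P.@[cubic_coord G] != 0 ->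
          SL_orbit_closed_in P G
      & finite_set (SL_stabilizer F)].

End CubicFourfolds.

(* Main.v *)
(* An E6~ germ is [u * (z_3^2 + z_4^2 + cubic)] in suitable coordinates, so its
   Hessian has rank at most 2. The Hessian of a deformation depends
   continuously on the point and on the parameter, and having rank at most 2 is
   a closed condition; hence a singularity deforming to E6~ has a Hessian of
   rank at most 2. If p is the singular point and T the symmetric trilinear
   form of the cubic F, the Hessian at p is T(p, -, -), and a basis
   (p, v_1, ..., v_5) with v_1, v_2, v_3 in its radical puts F in S6 form.

   The one-parameter subgroup with weights (2, 0, 0, 0, -1, -1) then degenerates
   F to a cubic F0 that it fixes. An invariant P not vanishing at F takes the
   same value at F0; if F were stable, F0 would lie in the orbit of F, and the
   stabilizer of F would contain a conjugate of the subgroup. *)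

Require Import Defs.
From mathcomp Require Import all_boot all_order all_algebra.
From mathcomp Require Import ring zify.
From mathcomp Require Import complex mpoly.
From mathcomp Require Import boolp classical_sets cardinality reals topology.
From mathcomp Require Import normedtype.

Set Implicit Arguments.
Unset Strict Implicit.
Unset Printing Implicit Defensive.

Import Order.TTheory GRing.Theory Num.Theory numFieldNormedType.Exports.

Local Open Scope classical_set_scope.
Local Open Scope ring_scope.

(** * Majorant estimates for convergent power series *)

Section PowerSeries.
Variable C : numFieldType.

Definition monom n (m : 'X_{1..n}) (x : 'rV[C]_n) : C :=
  \prod_(i < n) x 0 i ^+ m i.

Lemma monom0 n (x : 'rV[C]_n) : monom 0%MM x = 1.
Proof. by rewrite /monom big1 // => i _; rewrite mnm0E. Qed.

Lemma monomU n (i : 'I_n) (x : 'rV[C]_n) : monom U_(i)%MM x = x 0 i.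
Proof.
rewrite /monom (bigD1 i) //= mnm1E eqxx expr1 big1 ?mulr1 // => j ji.
by rewrite mnm1E eq_sym (negPf ji).
Qed.

Lemma monomD n (m m' : 'X_{1..n}) (x : 'rV[C]_n) :
  monom (m + m')%MM x = monom m x * monom m' x.
Proof.
by rewrite /monom -big_split; apply: eq_bigr => i _; rewrite mnmDE exprD.
Qed.

Lemma multinom_ind n (P : 'X_{1..n} -> Prop) :
  P 0%MM -> (forall i m, P m -> P (U_(i) + m)%MM) -> forall m, P m.
Proof.
move=> P0 PS m; have [d] := ubnP (mdeg m); elim: d m => // d IHd m.
have [->//|m0 md] := eqVneq m 0%MM.
have [i mi] : exists i, (m i != 0)%N.
  apply/existsP; apply: contraNT m0; rewrite negb_exists => /forallP h.
  by apply/eqP/mnmP => i; rewrite mnm0E; apply/eqP; rewrite -[_ == _]negbK h.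
have mE : m = (U_(i) + (m - U_(i)))%MM.
  rewrite addmC submK //; apply/mnm_lepP => j; rewrite mnm1E.
  by case: eqP => // <-; rewrite lt0n.
rewrite mE; apply: PS; apply: IHd.
by move: md; rewrite {1}mE mdegD mdeg1 add1n ltnS.
Qed.

Lemma geometric_sum_le2 (z : C) N :
  0 <= z -> 2 * z <= 1 -> \sum_(i < N) z ^+ i <= 2.
Proof.
move=> z0 z1; elim: N => [|N IHN]; first by rewrite big_ord0.
rewrite big_ord_recl expr0; under eq_bigr do rewrite exprS.
rewrite -mulr_sumr -[X in _ <= X]/(1 + 1) lerD2l.
by apply: le_trans z1; rewrite mulrC ler_wpM2r.
Qed.

(** Exponents of degree below [N] embed into the cube of functions from ['I_n] to ['I_N]; over the
    whole cube the sum factors into [n] geometric sums, each at most 2. *)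
Lemma multinom_sum_le n N (z : C) : 0 <= z -> 2 * z <= 1 ->
  \sum_(m : 'X_{1..n < N}) z ^+ mdeg m <= 2 ^+ n.
Proof.
move=> z0 z1.
have mN (m : 'X_{1..n < N}) i : (m i < N)%N.
  by apply: leq_ltn_trans (bmdeg m); rewrite mdegE (bigD1 i) //= leq_addr.
pose f (m : 'X_{1..n < N}) : {ffun 'I_n -> 'I_N} := [ffun i => Ordinal (mN m i)].
have f_inj : injective f.
  move=> m m' /ffunP e; apply/val_inj/mnmP => i.
  by have := e i; rewrite !ffunE => /(congr1 val).
pose G (g : {ffun 'I_n -> 'I_N}) : C := \prod_(i < n) z ^+ g i.
have -> : \sum_(m : 'X_{1..n < N}) z ^+ mdeg m = \sum_(g in f @: predT) G g.
  rewrite big_imset /=; last by move=> ? ? _ _; apply: f_inj.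
  apply: eq_bigr => m _; rewrite mdegE expr_sum.
  by apply: eq_bigr => i _; rewrite ffunE.
have G0 g : 0 <= G g by apply: prodr_ge0 => i _; rewrite exprn_ge0.
have -> : 2 ^+ n = \prod_(i < n) (2 : C).
  by rewrite big_const_ord iter_mulr_1.
apply: le_trans (_ : \prod_(i < n) \sum_(j < N) z ^+ j <= _).
  rewrite bigA_distr_bigA /= [X in _ <= X](bigID (mem (f @: predT))) /=.
  by apply: ler_wpDr => //; apply: sumr_ge0 => g _; apply: G0.
apply: ler_prod => i _; rewrite geometric_sum_le2 // andbT.
by apply: sumr_ge0 => j _; rewrite exprn_ge0.
Qed.

Lemma ex_pos_le2 (a b : C) :
  0 < a -> 0 < b -> exists c, [/\ 0 < c, c <= a & c <= b].
Proof.
(* The quotient [a * b / (a + b)] lies below both numbers, without a case distinction on which one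
   is smaller. *)
move=> a0 b0; have ab0 := addr_gt0 a0 b0; exists (a * b / (a + b)).
split; first by rewrite divr_gt0 // mulr_gt0.
- by rewrite ler_pdivrMr // ler_pM2l // lerDr ltW.
- by rewrite ler_pdivrMr // mulrC ler_pM2l // lerDl ltW.
Qed.

Lemma cvg_norm_le T (F : set_system T) (u : T -> C) (l K : C) :
  ProperFilter F -> (\forall x \near F, `|u x| <= K) -> u @ F --> l -> `|l| <= K.
Proof.
move=> FF uK /cvgrPdist_le ul; apply/ler_addgt0Pl => e /ul ule.
have [x [uKx ulx]] := filter_ex (filterI uK ule).
rewrite -[l](subrK (u x)); apply: le_trans (ler_normD _ _) _.
by rewrite lerD.
Qed.

(** Reduces estimates for a power series to its monomials: [a m] is meant to be a linear functional
    of the monomial [m], such as a Taylor remainder or a finite difference. Abel's condition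
    majorises the terms by [M * k * (q / r) ^+ mdeg m] with [q / r] at most 1/2, whence the factor
    [2 ^+ n]. *)
Lemma series_bound n (c a : 'X_{1..n} -> C) (r M q k l : C) :
    0 < r -> (forall m, `|c m| * r ^+ mdeg m <= M) ->
    0 <= k -> 0 <= q -> 2 * q <= r ->
    (forall m, `|a m| <= k * q ^+ mdeg m) ->
    (fun N => \sum_(m : 'X_{1..n < N}) c m * a m) @ \oo --> l ->
  `|l| <= 2 ^+ n * M * k.
Proof.
move=> r0 cM k0 q0 qr ak; apply: cvg_norm_le; apply: nearW => N.
have qr0 : 0 <= q / r by rewrite divr_ge0 // ltW.
have qr1 : 2 * (q / r) <= 1 by rewrite mulrA ler_pdivrMr // mul1r.
have M0 : 0 <= M by apply: le_trans (cM 0%MM); rewrite mulr_ge0 // exprn_ge0 // ltW.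
apply: le_trans (ler_norm_sum _ _ _) _.
rewrite -mulrA mulrC.
apply: le_trans (_ : \sum_(m : 'X_{1..n < N}) (M * k) * (q / r) ^+ mdeg m <= _).
  apply: ler_sum => m _; rewrite normrM.
  have rd : 0 < r ^+ mdeg m by rewrite exprn_gt0.
  apply: le_trans (ler_wpM2l (normr_ge0 _) (ak _)) _.
  rewrite exprMn exprVn.
  have -> : `|c m| * (k * q ^+ mdeg m) =
     (`|c m| * r ^+ mdeg m) * (k * (q ^+ mdeg m / r ^+ mdeg m)).
    by field; rewrite gt_eqF.
  rewrite -[M * k * _]mulrA; apply: ler_wpM2r; last exact: cM.
  by rewrite mulr_ge0 // divr_ge0 ?exprn_ge0 // ltW.
rewrite -mulr_sumr; apply: ler_wpM2l; first exact: mulr_ge0.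
exact: multinom_sum_le.
Qed.


Lemma monom_norm_le n (m : 'X_{1..n}) (x : 'rV[C]_n) (s : C) :
  (forall i, `|x 0 i| <= s) -> `|monom m x| <= s ^+ mdeg m.
Proof.
move=> xs; rewrite /monom normr_prod mdegE -prodrXr.
by apply: ler_prod => i _; rewrite normr_ge0 normrX lerXn2r ?nnegrE //
  (le_trans _ (xs i)).
Qed.

Lemma monom_at0 n (m : 'X_{1..n}) : m != 0%MM -> monom m 0 = 0.
Proof.
elim/multinom_ind: m => [|i m _ _]; first by rewrite eqxx.
by rewrite monomD monomU mxE mul0r.
Qed.

(** The remainder is estimated monomial by monomial: it vanishes in degrees 0 and 1, and in degree
    at least 2 it is bounded by [s ^+ 2 * (r / 2) ^+ (mdeg m - 2)]. *)
Lemma analytic_taylor1 n (f : 'rV[C]_n -> C) : analytic_at f 0 ->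
  exists (l : 'I_n -> C) (rho K : C), [/\ 0 < rho, 0 <= K &
    forall s (y : 'rV[C]_n), 0 <= s -> s <= rho -> (forall i, `|y 0 i| <= s) ->
      `|f y - f 0 - \sum_i l i * y 0 i| <= K * s ^+ 2].
Proof.
move=> [c [r [M [r0 cM cf]]]].
have r2 : 0 < r / 2 by rewrite divr_gt0.
have M0 : 0 <= M.
  by apply: le_trans (cM 0%MM); rewrite mulr_ge0 // exprn_ge0 // ltW.
exists (fun i => c U_(i)%MM), (r / 2), (2 ^+ n * M * (r / 2) ^- 2); split => //.
  by rewrite !mulr_ge0 // ?exprn_ge0 // invr_ge0 exprn_ge0 // ltW.
move=> s y s0 sr ys; rewrite -mulrA.
pose a m := monom m y - monom m 0 - \sum_i (m == U_(i)%MM)%:R * y 0 i.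
have r2r : r / 2 < r by rewrite ltr_pdivrMr // mulr_natr mulr2n ltrDl.
apply: (@series_bound _ c a r M (r / 2)) => //.
- by rewrite mulr_ge0 ?exprn_ge0 // invr_ge0 exprn_ge0 // ltW.
- exact: ltW.
- by rewrite mulrC divfK ?pnatr_eq0.
- move=> m; rewrite /a.
  have rhs0 : 0 <= (r / 2) ^- 2 * s ^+ 2 * (r / 2) ^+ mdeg m.
    by rewrite !mulr_ge0 ?exprn_ge0 // ?invr_ge0 ?exprn_ge0 // ltW.
  have [->|m0] := eqVneq m 0%MM.
    rewrite !monom0 subrr sub0r big1 ?oppr0 ?normr0 //; last first.
      by move=> i _; rewrite eq_sym mnm1_eq0 mul0r.
    by rewrite mdeg0 expr0 mulr1 mulr_ge0 ?exprn_ge0 // invr_ge0 exprn_ge0 // ltW.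
  rewrite (monom_at0 m0) subr0.
  have [|m1] := boolP (mdeg m == 1%N).
    rewrite mdeg_eq1 => /existsP[i /eqP mE]; rewrite mE monomU (bigD1 i) //=.
    rewrite eqxx mul1r big1 ?addr0 ?subrr ?normr0 -?mE //= => j ji.
    rewrite mE; case: eqP => [/mnmP/(_ i)|]; last by rewrite mul0r.
    by rewrite !mnm1E eqxx (negPf ji).
  rewrite big1 ?subr0; last first.
    move=> i _; case: eqP => [mE|]; last by rewrite mul0r.
    by rewrite mE mdeg1 in m1.
  apply: le_trans (monom_norm_le m ys) _.
  have m2 : (2 <= mdeg m)%N.
    by move: m0 m1; rewrite -mdeg_eq0; case: (mdeg m) => [|[]].
  rewrite -(subnKC m2) !exprD.
  have -> : (r / 2) ^- 2 * s ^+ 2 * ((r / 2) ^+ 2 * (r / 2) ^+ (mdeg m - 2)) =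
    s ^+ 2 * (r / 2) ^+ (mdeg m - 2).
    by field; rewrite gt_eqF.
  by apply: ler_wpM2l; rewrite ?exprn_ge0 // lerXn2r // nnegrE // ltW.
have cU i N : (2 <= N)%N ->
    \sum_(m : 'X_{1..n < N}) c m * (val m == U_(i)%MM)%:R = c U_(i)%MM.
  move=> N2; have UN : (mdeg U_(i) < N)%N by rewrite mdeg1.
  rewrite (bigD1 (BMultinom UN)) //= eqxx mulr1 big1 ?addr0 // => m mU.
  by rewrite (_ : _ == _ = false) ?mulr0 //; apply: contraNF mU.
(* From [N = 2] on, the truncated sum contains every linear monomial, so the linear part can be
   subtracted under the sum. *)
have SN : \forall N \near \oo, 
    \sum_(m : 'X_{1..n < N}) c m * monom m y -
    \sum_(m : 'X_{1..n < N}) c m * monom m 0 - \sum_i c U_(i)%MM * y 0 i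
    = \sum_(m : 'X_{1..n < N}) c m * a m.
  exists 2%N => // N /= N2.
  under [in RHS]eq_bigr do rewrite /a !mulrBr.
  rewrite !sumrB; congr (_ - _).
  under [in RHS]eq_bigr do rewrite mulr_sumr.
  rewrite exchange_big /=; apply: eq_bigr => i _; rewrite -(cU i N N2) mulr_suml.
  by apply: eq_bigr => m _; rewrite mulrA.
apply: cvg_trans (near_eq_cvg SN) _.
apply: cvgB; last exact: cvg_cst.
apply: cvgB.
  have := cf y; rewrite add0r; apply => i.
  exact: le_lt_trans (le_trans (ys i) sr) r2r.
have := cf 0; rewrite addr0; apply => i.
by rewrite mxE normr0.
Qed.

(** * Iterated finite differences of monomials and power series *)

Definition diff n (v : 'rV[C]_n) (f : 'rV[C]_n -> C) (x : 'rV[C]_n) : C :=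
  f (x + v) - f x.

Lemma ler_norm_mul3 (u v w U V : C) : 0 <= w ->
  `|u| <= U -> `|v| * w <= V -> `|u * v| * w <= U * V.
Proof. by move=> w0 uU vV; rewrite normrM -mulrA ler_pM // mulr_ge0. Qed.

Section MonomialDifferences.
Variables (n : nat) (rho : C).
Hypothesis rho0 : 0 <= rho.

(** Each difference moves the argument by at most [rho] in every coordinate, so the bound for [j]
    differences is proved on the box of size [(3 - j) * rho]. *)
Let box (k : nat) (x : 'rV[C]_n) := forall i, `|x 0 i| <= k%:R * rho.

Let boxD k s (x v : 'rV[C]_n) : s <= rho -> (forall i, `|v 0 i| <= s) ->
  box k x -> box k.+1 (x + v).
Proof.
move=> sr vs xk i; rewrite mxE -natr1 mulrDl mul1r.
apply: le_trans (ler_normD _ _) _.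
by rewrite lerD ?xk // (le_trans (vs i)).
Qed.

Lemma monom_diff0_le (m : 'X_{1..n}) (x : 'rV[C]_n) :
  box 3 x -> `|monom m x| <= (6 * rho) ^+ mdeg m.
Proof.
move=> x3; apply: monom_norm_le => i; apply: le_trans (x3 i) _.
by apply: ler_wpM2r => //; rewrite ler_nat.
Qed.

(** Induction on the monomial through the discrete product rule for a coordinate times a monomial.
    Powers of [rho] stand on the left, so that no division occurs. *)
Lemma monom_diff1_le (m : 'X_{1..n}) (x a : 'rV[C]_n) (s : C) :
    0 <= s -> s <= rho -> (forall i, `|a 0 i| <= s) -> box 2 x ->
  `|diff a (monom m) x| * rho <= s * (6 * rho) ^+ mdeg m.
Proof.
move=> s0 sr ha; elim/multinom_ind: m x => [|i m IHm] x x2.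
  by rewrite /diff !monom0 subrr normr0 mul0r mulr_ge0 // exprn_ge0 // mulr_ge0.
have -> : diff a (monom (U_(i) + m)%MM) x =
    x 0 i * diff a (monom m) x + a 0 i * monom m (x + a).
  by rewrite /diff !monomD !monomU mxE; ring.
rewrite mdegD mdeg1 [(6 * rho) ^+ _]exprS.
have h1 := IHm _ x2; have h2 := monom_diff0_le m (boxD sr ha x2).
set Q := (6 * rho) ^+ _ in h1 h2 *.
have Q0 : 0 <= Q by rewrite exprn_ge0 // mulr_ge0.
apply: le_trans (ler_wpM2r rho0 (ler_normD _ _)) _; rewrite mulrDl.
(* The two terms of the product rule take [3 * rho] out of the available [6 * rho]; the [*+ 3]
   summand is the surplus, dropped because it is nonnegative. *)
rewrite (_ : s * (6 * rho * Q) =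
  (2 * rho) * (s * Q) + s * (Q * rho) + (s * Q * rho) *+ 3); last by ring.
rewrite ler_wpDr ?mulrn_wge0 ?mulr_ge0 // lerD // ler_norm_mul3 //.
exact: ler_wpM2r.
Qed.

Lemma monom_diff2_le (m : 'X_{1..n}) (x a b : 'rV[C]_n) (s t : C) :
    0 <= s -> s <= rho -> (forall i, `|a 0 i| <= s) ->
    0 <= t -> t <= rho -> (forall i, `|b 0 i| <= t) -> box 1 x ->
  `|diff a (diff b (monom m)) x| * rho ^+ 2 <= s * t * (6 * rho) ^+ mdeg m.
Proof.
move=> s0 sr ha t0 tr hb; elim/multinom_ind: m x => [|i m IHm] x x1.
  by rewrite /diff !monom0 !subrr normr0 mul0r !mulr_ge0 // exprn_ge0 // mulr_ge0.
have -> : diff a (diff b (monom (U_(i) + m)%MM)) x =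
    x 0 i * diff a (diff b (monom m)) x + a 0 i * diff b (monom m) (x + a)
    + b 0 i * diff a (monom m) (x + b).
  by rewrite /diff !monomD !monomU !mxE [x + b + a]addrAC; ring.
rewrite mdegD mdeg1 [(6 * rho) ^+ _]exprS.
have h1 := IHm _ x1.
have h2 := monom_diff1_le m t0 tr hb (boxD sr ha x1).
have h3 := monom_diff1_le m s0 sr ha (boxD tr hb x1).
set Q := (6 * rho) ^+ _ in h1 h2 h3 *.
have Q0 : 0 <= Q by rewrite exprn_ge0 // mulr_ge0.
have r2 : 0 <= rho ^+ 2 by rewrite exprn_ge0.
apply: le_trans (ler_wpM2r r2 (le_trans (ler_normD _ _)
  (lerD (ler_normD _ _) (lexx _)))) _.
rewrite [X in X <= _]mulrDl [X in X + _ <= _]mulrDl.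
rewrite (_ : s * t * (6 * rho * Q) =
  (1 * rho) * (s * t * Q) + s * (t * Q * rho) + t * (s * Q * rho)
  + (s * t * Q * rho) *+ 3); last by ring.
rewrite ler_wpDr ?mulrn_wge0 ?mulr_ge0 // !lerD // ler_norm_mul3 //.
- by rewrite expr2 mulrA ler_wpM2r.
- by rewrite expr2 mulrA ler_wpM2r.
Qed.

Lemma monom_diff3_le (m : 'X_{1..n}) (a b d : 'rV[C]_n) (s t w : C) :
    0 <= s -> s <= rho -> (forall i, `|a 0 i| <= s) ->
    0 <= t -> t <= rho -> (forall i, `|b 0 i| <= t) ->
    0 <= w -> w <= rho -> (forall i, `|d 0 i| <= w) ->
  `|diff a (diff b (diff d (monom m))) 0| * rho ^+ 3 <=
    s * t * w * (6 * rho) ^+ mdeg m.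
Proof.
move=> s0 sr ha t0 tr hb w0 wr hd; elim/multinom_ind: m => [|i m IHm].
  by rewrite /diff !monom0 !subrr normr0 mul0r !mulr_ge0 // exprn_ge0 // mulr_ge0.
(* At the origin the coordinate [x 0 i] is zero, so the product rule leaves only the three terms
   with two differences. *)
have -> : diff a (diff b (diff d (monom (U_(i) + m)%MM))) 0 =
    a 0 i * diff b (diff d (monom m)) (0 + a)
    + b 0 i * diff a (diff d (monom m)) (0 + b)
    + d 0 i * diff a (diff b (monom m)) (0 + d).
  rewrite /diff !monomD !monomU !mxE !add0r [b + a]addrC [d + a]addrC.
  by rewrite [d + b]addrC [a + d + b]addrAC; ring.
rewrite mdegD mdeg1 [(6 * rho) ^+ _]exprS.
have box0 : box 0 0 by move=> j; rewrite mxE normr0 mul0r.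
have h1 := monom_diff2_le m t0 tr hb w0 wr hd (boxD sr ha box0).
have h2 := monom_diff2_le m s0 sr ha w0 wr hd (boxD tr hb box0).
have h3 := monom_diff2_le m s0 sr ha t0 tr hb (boxD wr hd box0).
set Q := (6 * rho) ^+ _ in h1 h2 h3 *.
have Q0 : 0 <= Q by rewrite exprn_ge0 // mulr_ge0.
have r3 : 0 <= rho ^+ 3 by rewrite exprn_ge0.
apply: le_trans (ler_wpM2r r3 (le_trans (ler_normD _ _)
  (lerD (ler_normD _ _) (lexx _)))) _.
rewrite [X in X <= _]mulrDl [X in X + _ <= _]mulrDl.
rewrite (_ : s * t * w * (6 * rho * Q) =
  s * (t * w * Q * rho) + t * (s * w * Q * rho) + w * (s * t * Q * rho)
  + (s * t * w * Q * rho) *+ 3); last by ring.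
by rewrite ler_wpDr ?mulrn_wge0 ?mulr_ge0 // !lerD // ler_norm_mul3 //
  exprSr mulrA ler_wpM2r.
Qed.

End MonomialDifferences.

(* With [a] small and [b], [d] of order [s], dividing by [s ^+ 2] shows that the
   second derivatives at [a] and at [0] differ by [O(|a|)]. No derivative of a
   power series is ever formed. *)
Lemma analytic_diff3_le n (f : 'rV[C]_n -> C) : analytic_at f 0 ->
  exists rho K : C, [/\ 0 < rho, 0 <= K &
    forall (a b d : 'rV[C]_n) (s t w : C),
      0 <= s -> s <= rho -> (forall i, `|a 0 i| <= s) ->
      0 <= t -> t <= rho -> (forall i, `|b 0 i| <= t) ->
      0 <= w -> w <= rho -> (forall i, `|d 0 i| <= w) ->
      `|diff a (diff b (diff d f)) 0| <= K * (s * t * w)].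
Proof.
move=> [c [r [M [r0 cM cf]]]].
(* This makes [6 * rho] equal to [r / 2], the ratio that [series_bound] requires, and keeps all sums
   of three steps, of size at most [3 * rho], inside the polydisc of convergence. *)
pose rho := r / 12.
have rho0 : 0 < rho by rewrite divr_gt0.
have rE : r = 12 * rho by rewrite mulrC divfK ?pnatr_eq0.
have M0 : 0 <= M.
  by apply: le_trans (cM 0%MM); rewrite mulr_ge0 // exprn_ge0 // ltW.
have rho3 : 0 < rho ^+ 3 by rewrite exprn_gt0.
exists rho, (2 ^+ n * M * rho ^- 3); split => //.
  by rewrite !mulr_ge0 // ?exprn_ge0 // invr_ge0 ltW.
move=> a b d s t w s0 sr ha t0 tr hb w0 wr hd; rewrite -mulrA.
pose A m := diff a (diff b (diff d (monom m))) 0.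
apply: (@series_bound _ c A r M (6 * rho)) => //.
- by rewrite mulr_ge0 ?mulr_ge0 // invr_ge0 ltW.
- by rewrite mulr_ge0 // ltW.
- by rewrite rE mulrA -natrM.
- move=> m; rewrite -mulrA ler_pdivlMl // mulrC.
  by apply: monom_diff3_le => //; apply: ltW.
have cv (x y z : 'rV[C]_n) : (forall i, `|x 0 i| <= s) ->
    (forall i, `|y 0 i| <= t) -> (forall i, `|z 0 i| <= w) ->
    (fun N => \sum_(m : 'X_{1..n < N}) c m * monom m (x + y + z)) @ \oo -->
      f (x + y + z).
  move=> xs yt zw; have := cf (x + y + z); rewrite add0r; apply => i.
  apply: le_lt_trans (_ : s + t + w < r).
    rewrite !mxE; apply: le_trans (ler_normD _ _) _; rewrite lerD //.
    by apply: le_trans (ler_normD _ _) _; rewrite lerD.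
  apply: le_lt_trans (lerD (lerD sr tr) wr) _.
  have -> : rho + rho + rho = 3 * rho by ring.
  by rewrite rE ltr_pM2r // ltr_nat.
have z0 u : 0 <= u -> forall i, `|(0 : 'rV[C]_n) 0 i| <= u.
  by move=> u0 i; rewrite mxE normr0.
(* Convergence is known at each of the eight corners separately; the zero summands are kept so that
   [cv] covers all corners in one form. *)
have -> : (fun N => \sum_(m : 'X_{1..n < N}) c m * A m) =
  (fun N => \sum_(m : 'X_{1..n < N}) c m * monom m (a + b + d)
    - \sum_(m : 'X_{1..n < N}) c m * monom m (a + b + 0)
    - (\sum_(m : 'X_{1..n < N}) c m * monom m (a + 0 + d)
       - \sum_(m : 'X_{1..n < N}) c m * monom m (a + 0 + 0))
    - (\sum_(m : 'X_{1..n < N}) c m * monom m (0 + b + d)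
       - \sum_(m : 'X_{1..n < N}) c m * monom m (0 + b + 0)
       - (\sum_(m : 'X_{1..n < N}) c m * monom m (0 + 0 + d)
          - \sum_(m : 'X_{1..n < N}) c m * monom m (0 + 0 + 0)))).
  apply/funext => N; rewrite -!sumrB; apply: eq_bigr => m _.
  by rewrite -!mulrBr /A /diff !addr0 !add0r.
have -> : diff a (diff b (diff d f)) 0 =
  f (a + b + d) - f (a + b + 0) - (f (a + 0 + d) - f (a + 0 + 0))
  - (f (0 + b + d) - f (0 + b + 0) - (f (0 + 0 + d) - f (0 + 0 + 0))).
  by rewrite /diff !addr0 !add0r.
by do 3![apply: cvgB]; apply: cv => //; apply: z0.
Qed.

(** * Limits along lines and the Hessian of an E6~ germ *)

Lemma nbhs0_boxP n (P : 'rV[C]_n -> Prop) :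
  (\forall z \near (0 : 'rV[C]_n), P z) <->
  exists2 d : C, 0 < d & forall z : 'rV[C]_n, (forall i, `|z 0 i| < d) -> P z.
Proof.
split=> [/nbhs_ballP[d /= d0 dP]|[d d0 dP]].
  exists d => // z zd; apply: dP; split=> // i j.
  rewrite !ord1 /ball /= mxE sub0r normrN.
  exact: zd.
apply/nbhs_ballP; exists d => // z zd; apply: dP => i.
by have := zd.2 0 i; rewrite /ball /= mxE sub0r normrN.
Qed.

Lemma near0_line n (P : 'rV[C]_n -> Prop) (w : 'rV[C]_n) :
  (\forall z \near (0 : 'rV[C]_n), P z) -> \forall s \near (0 : C)^', P (s *: w).
Proof.
move=> /nbhs0_boxP[d d0 dP].
have W0 : 0 < 1 + \sum_i `|w 0 i| by rewrite ltr_pwDl // sumr_ge0.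
near=> s; apply: dP => i; rewrite mxE normrM.
apply: le_lt_trans (_ : `|s| * (1 + \sum_i `|w 0 i|) < d).
  apply: ler_wpM2l => //; rewrite (bigD1 i) //= addrCA lerDl.
  by rewrite addr_ge0 // sumr_ge0.
rewrite -ltr_pdivlMr //; near: s.
by apply: dnbhs0_lt; rewrite divr_gt0.
Unshelve. all: by end_near. Qed.

Lemma analytic_line_cvg n (f : 'rV[C]_n -> C) : analytic_at f 0 ->
  exists l : 'I_n -> C, forall w : 'rV[C]_n,
    s^-1 * (f (s *: w) - f 0) @[s --> (0 : C)^'] --> \sum_i l i * w 0 i.
Proof.
move=> /analytic_taylor1[l [rho [K [rho0 K0 fK]]]]; exists l => w.
pose W := 1 + \sum_i `|w 0 i|.
have W0 : 0 < W by rewrite ltr_pwDl // sumr_ge0.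
have wW i : `|w 0 i| <= W.
  by rewrite /W (bigD1 i) //= addrCA lerDl addr_ge0 // sumr_ge0.
have KW : 0 < 1 + K * W ^+ 2 by rewrite ltr_pwDl // mulr_ge0 // exprn_ge0 // ltW.
apply/cvgrPdist_le => e e0; near=> s.
have s0 : s != 0 by near: s; exact: nbhs_dnbhs_neq.
have ns0 : 0 < `|s| by rewrite normr_gt0.
have -> : \sum_i l i * w 0 i - s^-1 * (f (s *: w) - f 0) =
    - s^-1 * (f (s *: w) - f 0 - \sum_i l i * (s *: w) 0 i).
  have -> : \sum_i l i * (s *: w) 0 i = s * \sum_i l i * w 0 i.
    by rewrite mulr_sumr; apply: eq_bigr => i _; rewrite mxE mulrCA.
  by field.
rewrite normrM normrN normfV ler_pdivrMl //.
apply: le_trans (fK (`|s| * W) _ _ _ _) _.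
- by rewrite mulr_ge0 // ltW.
- rewrite -ler_pdivlMr //; near: s; apply: dnbhs0_le.
  exact: divr_gt0.
- by move=> i; rewrite mxE normrM ler_wpM2l.
have -> : K * (`|s| * W) ^+ 2 = `|s| * (`|s| * (K * W ^+ 2)) by ring.
rewrite ler_pM2l //.
apply: le_trans (_ : `|s| * (1 + K * W ^+ 2) <= _).
  by rewrite ler_wpM2l // lerDr.
rewrite -ler_pdivlMr //; near: s; apply: dnbhs0_le.
exact: divr_gt0.
Unshelve. all: by end_near. Qed.

Lemma analytic_continuous0 n (f : 'rV[C]_n -> C) : analytic_at f 0 ->
  f z @[z --> (0 : 'rV[C]_n)] --> f 0.
Proof.
move=> /analytic_taylor1[l [rho [K [rho0 K0 fK]]]].
apply/(@cvgrPdist_le _ _ _ _ (nbhs_filter (0 : 'rV[C]_n))) => e e0.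
pose L := 1 + \sum_i `|l i| + K * rho.
have L0 : 0 < L.
  by rewrite /L -addrA ltr_pwDl // addr_ge0 ?mulr_ge0 // ?sumr_ge0 // ltW.
have [d [d0 dr de]] := ex_pos_le2 rho0 (divr_gt0 e0 L0).
apply/nbhs0_boxP; exists d => // z zd.
have zd' i : `|z 0 i| <= d by exact: ltW.
rewrite distrC -[f z - f 0](subrK (\sum_i l i * z 0 i)).
apply: le_trans (ler_normD _ _) _.
apply: le_trans (lerD (fK _ _ (ltW d0) dr zd') (ler_norm_sum _ _ _)) _.
rewrite ler_pdivlMr // in de; apply: le_trans de.
rewrite /L mulrDr addrC lerD //; last first.
  by rewrite expr2 mulrC -mulrA ler_pM2l // mulrC ler_wpM2l.
rewrite mulrDr mulr1; apply: ler_wpDl; first exact: ltW.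
rewrite mulr_sumr; apply: ler_sum => i _.
by rewrite normrM mulrC ler_wpM2r.
Qed.

Lemma analytic_map_continuous0 n k (f : 'rV[C]_n -> 'rV[C]_k) :
  analytic_map_at f 0 -> f 0 = 0 ->
  f z @[z --> (0 : 'rV[C]_n)] --> (0 : 'rV[C]_k).
Proof.
move=> fa f0 P /nbhs0_boxP[d d0 dP].
have fj j : \forall z \near (0 : 'rV[C]_n), `|f z 0 j| < d.
  have /(@cvgrPdist_lt _ _ _ _ (nbhs_filter (0 : 'rV[C]_n)))/(_ _ d0) :=
    analytic_continuous0 (fa j).
  by apply: filterS => z; rewrite f0 mxE sub0r normrN.
have := filter_forall (nbhs_filter (0 : 'rV[C]_n)) fj.
by apply: (@filterS _ _ (nbhs_filter (0 : 'rV[C]_n))) => z; apply: dP.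
Qed.

(* The second difference along [s e_i], [s e_j], divided by [s ^+ 2], tends to the
   Hessian. *)
Lemma class_E6t_diff2_cvg (h : 'rV[C]_5 -> C) : class_E6t h ->
  exists2 A : 'M[C]_5, (\rank A <= 2)%N & forall i j,
    s ^- 2 * diff (s *: delta_mx 0 i) (diff (s *: delta_mx 0 j) h) 0
      @[s --> (0 : C)^'] --> A i j.
Proof.
move=> [a [phi [u [_ [psi [[phi0 psi0] _ psia _ phiK]] ua _ huE]]]].
have psic := analytic_map_continuous0 psia psi0.
(* The normal form is pulled back by the inverse [psi], so that only the first-order expansion of
   [psi] along lines enters. *)
have hE : \forall w \near (0 : 'rV[C]_5), h w = u (psi w) * E6t_form a (psi w).
  have := psic _ huE.
  apply: (filterS2 (nbhs_filter (0 : 'rV[C]_5)) _ phiK) => w phiKw.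
  by rewrite /= phiKw.
have [l lP] : exists l : 'I_5 -> 'I_5 -> C, forall k (w : 'rV[C]_5),
    s^-1 * psi (s *: w) 0 k @[s --> (0 : C)^'] --> \sum_i l k i * w 0 i.
  have /choice[l lP] k := analytic_line_cvg (psia k).
  by exists l => k w; have := lP k w; rewrite psi0 mxE; under eq_fun do rewrite subr0.
pose L k (w : 'rV[C]_5) := \sum_i l k i * w 0 i.
pose q w := u 0 * (L 3 w ^+ 2 + L 4 w ^+ 2).
have hq w : s ^- 2 * h (s *: w) @[s --> (0 : C)^'] --> q w.
  have uc : u (psi (s *: w)) @[s --> (0 : C)^'] --> u 0.
    move=> P /(analytic_continuous0 ua)/psic; exact: near0_line.
  pose v k s := s^-1 * psi (s *: w) 0 k.
  (* With [psi (s *: w) = s * v], division by [s ^+ 2] leaves the two squares, while the cubic terms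
     keep a factor [s] and disappear in the limit. *)
  have eqn : \forall s \near (0 : C)^', 
      u (psi (s *: w)) * (v 3 s * v 3 s + v 4 s * v 4 s + s *
       (v 0 s * v 0 s * v 0 s + v 1 s * v 1 s * v 1 s + v 2 s * v 2 s * v 2 s
        + a * (v 0 s * v 1 s * v 2 s))) = s ^- 2 * h (s *: w).
    near=> s.
    have s0 : s != 0 by near: s; exact: nbhs_dnbhs_neq.
    have -> : h (s *: w) = u (psi (s *: w)) * E6t_form a (psi (s *: w)).
      near: s; exact: near0_line hE.
    by rewrite /E6t_form /v; field.
  apply: cvg_trans (near_eq_cvg eqn) _.
  have -> : q w = u 0 * (L 3 w * L 3 w + L 4 w * L 4 w + 0 *
       (L 0 w * L 0 w * L 0 w + L 1 w * L 1 w * L 1 w + L 2 w * L 2 w * L 2 w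
        + a * (L 0 w * L 1 w * L 2 w))) by rewrite /q; ring.
  have vc k : v k s @[s --> (0 : C)^'] --> L k w by exact: lP.
  have sc : s @[s --> (0 : C)^'] --> (0 : C) by exact: cvg_within.
  have ac : a @[s --> (0 : C)^'] --> a by exact: cvg_cst.
  by repeat first [exact: vc | exact: sc | exact: ac | exact: uc
    | apply: cvgM | apply: cvgD].
pose e i : 'rV[C]_5 := delta_mx 0 i.
have Le k i : L k (e i) = l k i.
  rewrite /L (bigD1 i) //= mxE !eqxx mulr1 big1 ?addr0 // => j ji.
  by rewrite mxE (negPf ji) andbF mulr0.
have Lee k i j : L k (e i + e j) = l k i + l k j.
  rewrite -!Le /L -big_split; apply: eq_bigr => m _.
  by rewrite mxE mulrDr.
have L0 k : L k 0 = 0 by rewrite /L big1 // => i _; rewrite mxE mulr0.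
(* The polarisation of [q] factors through the two linear forms [L 3] and [L 4], so its matrix is a
   product through dimension 2. *)
pose X : 'M[C]_(5, 2) := \matrix_(i, k)
  (2 * u 0 * (if k == 0 then l 3 i else l 4 i)).
pose Y : 'M[C]_(2, 5) := \matrix_(k, i) (if k == 0 then l 3 i else l 4 i).
exists (X *m Y); first exact: mulmx_max_rank.
move=> i j.
have -> : (X *m Y) i j = q (e i + e j) - q (e i) - (q (e j) - q 0).
  by rewrite !mxE !big_ord_recl big_ord0 /= !mxE /= /q !Lee !Le !L0; ring.
have -> : (fun s => s ^- 2 * diff (s *: e i) (diff (s *: e j) h) 0) =
  (fun s => s ^- 2 * h (s *: (e i + e j)) - s ^- 2 * h (s *: e i)
     - (s ^- 2 * h (s *: e j) - s ^- 2 * h (s *: 0))).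
  by apply/funext => s; rewrite /diff !add0r scalerDr scaler0; ring.
by do 2![apply: cvgB]; apply: hq.
Unshelve. all: by end_near. Qed.


(** * Semicontinuity of the rank of the Hessian *)

Lemma mulmx3_norm_le m n k l (L : 'M[C]_(m, n)) (R : 'M[C]_(k, l)) :
  exists2 K : C, 0 <= K & forall (E : 'M[C]_(n, k)) (e : C), 0 <= e ->
    (forall i j, `|E i j| <= e) -> forall i j, `|(L *m E *m R) i j| <= K * e.
Proof.
pose K i j := \sum_b \sum_a `|L i a| * `|R b j|.
have K0 i j : 0 <= K i j by do 2![apply: sumr_ge0 => ? _]; rewrite mulr_ge0.
exists (\sum_i \sum_j K i j); first by do 2![apply: sumr_ge0 => ? _].
move=> E e e0 Ee i j; apply: le_trans (_ : K i j * e <= _); last first.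
  apply: ler_wpM2r => //; rewrite (bigD1 i) //= (bigD1 j) //= -addrA lerDl.
  by apply: addr_ge0; apply: sumr_ge0 => ? _ //; apply: sumr_ge0.
rewrite mxE mulr_suml; apply: le_trans (ler_norm_sum _ _ _) _.
apply: ler_sum => b _; rewrite mxE normrM mulr_suml.
apply: le_trans (ler_wpM2r (normr_ge0 _) (ler_norm_sum _ _ _)) _.
rewrite mulr_suml; apply: ler_sum => a _.
by rewrite normrM mulrAC ler_wpM2l // mulr_ge0.
Qed.

(* If [L A0 R = 1] with [k + 1] rows, then [L A R] is close to [1] for [A] close
   to [A0], hence invertible. *)
Lemma mxrank_le_of_approx m n k (A0 : 'M[C]_(m, n)) :
    (forall e : C, 0 < e -> exists2 A : 'M[C]_(m, n), (\rank A <= k)%N &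
      forall i j, `|A0 i j - A i j| <= e) ->
  (\rank A0 <= k)%N.
Proof.
move=> approx; rewrite leqNgt; apply/negP => k_lt.
have [L [R LR1]] : exists (L : 'M[C]_(k.+1, m)) (R : 'M[C]_(n, k.+1)),
    L *m A0 *m R = 1%:M.
  exists (pid_mx k.+1 *m invmx (col_ebase A0)).
  exists (invmx (row_ebase A0) *m pid_mx k.+1).
  rewrite -{2}(mulmx_ebase A0) -!mulmxA (mulKmx (col_ebase_unit A0)).
  rewrite (mulKVmx (row_ebase_unit A0)) mulmxA !mul_pid_mx.
  rewrite -pid_mx_1; congr pid_mx.
  by have := rank_leq_col A0; have := rank_leq_row A0; lia.
have [K K0 LRK] := mulmx3_norm_le L R.
(* Chosen so that [k.+1%:R * (K * e)] is at most 1/2; [1 + K] replaces [K], which may be zero. *)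
pose e : C := (2 * k.+1%:R * (1 + K))^-1.
have K1 : 0 < 1 + K by rewrite ltr_pwDl.
have e0 : 0 < e by rewrite invr_gt0 !mulr_gt0 // ltr0n.
have [A rkA Ae] := approx e e0.
have : ~~ row_free (L *m A *m R).
  rewrite /row_free neq_ltn (leq_ltn_trans _ (leqnn k.+1)) //.
  by apply: leq_trans (mxrankM_maxl _ _) (leq_trans (mxrankM_maxr _ _) rkA).
(* A kernel vector [v] of [L *m A *m R] is fixed by the small matrix [L *m (A0 - A) *m R]; comparing
   the sum [N] of the norms of its entries on both sides gives [N <= N / 2], hence [v = 0]. *)
rewrite -kermx_eq0 => /rowV0Pn[v /sub_kermxP vB v0].
pose N := \sum_j `|v 0 j|.
have vE : v = v *m (L *m (A0 - A) *m R).
  by rewrite mulmxBr mulmxBl LR1 mulmxBr mulmx1 vB subr0.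
have N2 : N <= N / 2.
  rewrite {1}/N; apply: le_trans (_ : \sum_(j < k.+1) N * (K * e) <= _).
    apply: ler_sum => j _; rewrite vE mxE.
    apply: le_trans (ler_norm_sum _ _ _) _; rewrite /N mulr_suml.
    apply: ler_sum => i _; rewrite normrM ler_wpM2l // LRK ?ltW // => i' j'.
    by rewrite !mxE Ae.
  rewrite sumr_const card_ord -[_ *+ k.+1]mulr_natr -mulrA; apply: ler_wpM2l.
    by apply: sumr_ge0.
  have -> : 2^-1 = (1 + K) * e * k.+1%:R.
    have : k.+1%:R != 0 :> C by rewrite pnatr_eq0.
    by rewrite /e; move: (k.+1%:R : C) => x x0; field; rewrite gt_eqF.
  by rewrite ler_wpM2r // ler_wpM2r ?ltW // ltrDr.
have N0 : N = 0.
  apply/le_anti/andP; split; last by apply: sumr_ge0.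
  by move: N2; rewrite ler_pdivlMr // mulr_natr mulr2n gerDl.
case/negP: v0; apply/eqP/rowP => j; rewrite mxE; apply/eqP.
rewrite -normr_le0 -N0 /N (bigD1 j) //= lerDl.
by apply: sumr_ge0.
Qed.

(** The second differences of [G] at [(y, t)] and at the origin differ by a third difference of [G],
    of size at most [K * d * |s|^2]. Dividing by [s ^+ 2] and letting [s] tend to 0 bounds the
    entries of [A0 - A] by [K * d]. *)
Lemma deforms_to_E6t_rank (h : 'rV[C]_5 -> C) (A0 : 'M[C]_5) :
    deforms_to_E6t h ->
    (forall i j, s ^- 2 * diff (s *: delta_mx 0 i) (diff (s *: delta_mx 0 j) h) 0
      @[s --> (0 : C)^'] --> A0 i j) ->
  (\rank A0 <= 2)%N.
Proof.
move=> [k [G [Ga Gh GE]]] hA0; apply: mxrank_le_of_approx => e e0.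
have [rho [K [rho0 K0 GK]]] := analytic_diff3_le Ga.
have K1 : 0 < 1 + K by rewrite ltr_pwDl.
have [d [d0 dr de]] := ex_pos_le2 rho0 (divr_gt0 e0 K1).
have [y [t [yd td /class_E6t_diff2_cvg[A rkA hA]]]] := GE d d0.
exists A => // i j.
apply: le_trans (_ : K * d <= e); last first.
  apply: le_trans (_ : (1 + K) * d <= _); first by rewrite ler_pM2r // lerDr.
  by rewrite mulrC -ler_pdivlMr.
pose D0 s := diff (s *: delta_mx 0 i) (diff (s *: delta_mx 0 j) h) 0.
pose D1 s := diff (s *: delta_mx 0 i) (diff (s *: delta_mx 0 j)
  (fun z => G (row_mx (y + z) t))) 0.
have cvgAB : s ^- 2 * D0 s - s ^- 2 * D1 s @[s --> (0 : C)^'] --> A0 i j - A i j.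
  exact: cvgB (hA0 i j) (hA i j).
apply: cvg_norm_le cvgAB; near=> s.
have s0 : s != 0 by near: s; exact: nbhs_dnbhs_neq.
have ns0 : 0 < `|s| by rewrite normr_gt0.
have hij : G (row_mx (s *: delta_mx 0 i + s *: delta_mx 0 j) 0) =
    h (s *: delta_mx 0 i + s *: delta_mx 0 j).
  by rewrite -scalerDr; near: s; apply: near0_line Gh.
have hi : G (row_mx (s *: delta_mx 0 i) 0) = h (s *: delta_mx 0 i).
  by near: s; apply: near0_line Gh.
have hj : G (row_mx (s *: delta_mx 0 j) 0) = h (s *: delta_mx 0 j).
  by near: s; apply: near0_line Gh.
have h0 : G 0 = h 0.
  by have := nbhs_singleton Gh; rewrite row_mx0.
pose a : 'rV[C]_(5 + k) := row_mx y t.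
pose b : 'rV[C]_(5 + k) := row_mx (s *: delta_mx 0 i) 0.
pose c : 'rV[C]_(5 + k) := row_mx (s *: delta_mx 0 j) 0.
rewrite -mulrBr.
have -> : D0 s - D1 s = - diff a (diff b (diff c G)) 0.
  rewrite /D0 /D1 /diff !add0r /a /b /c !add_row_mx !addr0 !addrA hij hi hj h0.
  by ring.
have se l m : `|(s *: delta_mx 0 l : 'rV[C]_5) 0 m| <= `|s|.
  by rewrite !mxE normrM ler_piMr // eqxx /=; case: eqP; rewrite ?normr1 ?normr0.
have split_le (x : 'rV[C]_5) (z : 'rV[C]_k) (q : C) :
    (forall l, `|x 0 l| <= q) -> (forall l, `|z 0 l| <= q) ->
    forall l, `|row_mx x z 0 l| <= q.
  by move=> xq zq l; rewrite mxE; case: splitP => m _.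
have z0 l : `|(0 : 'rV[C]_k) 0 l| <= `|s| by rewrite mxE normr0.
have srho : `|s| <= rho by near: s; exact: dnbhs0_le.
rewrite normrM normrN normfV normrX ler_pdivrMl ?exprn_gt0 //.
rewrite (_ : _ * (K * d) = K * (d * `|s| * `|s|)); last by ring.
apply: GK => //; try exact: ltW; apply: split_le => //; try by move=> l; apply/ltW.
Unshelve. all: by end_near. Qed.

End PowerSeries.

(** * Polarisation of cubic forms *)

Section CubicForms.
Variables (C : numFieldType) (n : nat).
Implicit Types (F : {mpoly C[n]}) (a b c x : 'rV[C]_n).

Lemma mdeg3P (m : 'X_{1..n}) : mdeg m = 3%N ->
  exists i j k, m = (U_(i) + U_(j) + U_(k))%MM.
Proof.
elim/multinom_ind: m => [|i m _]; first by rewrite mdeg0.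
rewrite mdegD mdeg1 => -[]; elim/multinom_ind: m => [|j m _]; first by rewrite mdeg0.
rewrite mdegD mdeg1 => -[] /eqP; rewrite mdeg_eq1 => /existsP[k /eqP ->].
by exists i, j, k; rewrite addmA.
Qed.

(** Identities that are linear in the form reduce to products of three variables, where [ring]
    decides them. *)
Lemma homog3_ind (P : {mpoly C[n]} -> Prop) : P 0 ->
    (forall (z : C) i j k F, P F -> P (z *: ('X_i * 'X_j * 'X_k) + F)) ->
  forall F, F \is 3.-homog -> P F.
Proof.
move=> P0 PD F /dhomogP hF; rewrite [F]mpolyE.
elim: (msupp F) hF => [|m s IHs] hs; first by rewrite big_nil.
rewrite big_cons.
have [i [j [k ->]]] := mdeg3P (hs m (mem_head _ _)).
rewrite !mpolyXD; apply: PD; apply: IHs => m' m's.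
by apply: hs; rewrite inE m's orbT.
Qed.

(* For a cubic form this is its symmetric trilinear form. *)
Definition polar F a b c : C :=
  F.@[(a + b + c) 0] - F.@[(a + b) 0] - F.@[(a + c) 0] - F.@[(b + c) 0]
  + F.@[a 0] + F.@[b 0] + F.@[c 0].

Lemma polarC12 F a b c : polar F a b c = polar F b a c.
Proof. by rewrite /polar [b + a]addrC; ring. Qed.

Lemma polarC23 F a b c : polar F a b c = polar F a c b.
Proof. by rewrite /polar [c + b]addrC [a + c + b]addrAC; ring. Qed.

Lemma polarZD z F F' a b c :
  polar (z *: F + F') a b c = z * polar F a b c + polar F' a b c.
Proof. by rewrite /polar !mevalD !mevalZ; ring. Qed.

Lemma polar0 a b c : polar 0 a b c = 0.
Proof. by rewrite /polar !meval0; ring. Qed.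

Lemma polarXXX i j k a b c : polar ('X_i * 'X_j * 'X_k) a b c =
  a 0 i * b 0 j * c 0 k + a 0 i * c 0 j * b 0 k + b 0 i * a 0 j * c 0 k
  + b 0 i * c 0 j * a 0 k + c 0 i * a 0 j * b 0 k + c 0 i * b 0 j * a 0 k.
Proof. by rewrite /polar !mevalM !mevalXU !mxE; ring. Qed.

Lemma polar_linear F a b c c' (z : C) : F \is 3.-homog ->
  polar F a b (z *: c + c') = z * polar F a b c + polar F a b c'.
Proof.
elim/homog3_ind => [|y i j k F' IHF']; first by rewrite !polar0; ring.
by rewrite !polarZD IHF' !polarXXX !mxE; ring.
Qed.

Lemma polarZr F a b c (z : C) : F \is 3.-homog ->
  polar F a b (z *: c) = z * polar F a b c.
Proof.
elim/homog3_ind => [|y i j k F' IHF']; first by rewrite !polar0 mulr0.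
by rewrite !polarZD IHF' !polarXXX !mxE; ring.
Qed.

Lemma polarZm F a b c (z : C) : F \is 3.-homog ->
  polar F a (z *: b) c = z * polar F a b c.
Proof. by move=> hF; rewrite polarC23 polarZr // polarC23. Qed.

Lemma polar_sumr F a b (I : finType) (z : I -> C) (v : I -> 'rV[C]_n) :
    F \is 3.-homog ->
  polar F a b (\sum_i z i *: v i) = \sum_i z i * polar F a b (v i).
Proof.
move=> hF; apply: (big_ind2 (fun u r => polar F a b u = r)) =>
  [|x y x' y' <- <-|i _]; last exact: polarZr.
  by rewrite -[0](scale0r (0 : 'rV[C]_n)) polarZr // mul0r.
by have := polar_linear a b x x' 1 hF; rewrite scale1r mul1r.
Qed.

Lemma meval_homog3Z F x (z : C) : F \is 3.-homog ->
  F.@[(z *: x) 0] = z ^+ 3 * F.@[x 0].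
Proof.
elim/homog3_ind => [|y i j k F' IHF']; first by rewrite !meval0 mulr0.
by rewrite !mevalD !mevalZ !mevalM !mevalXU IHF' !mxE; ring.
Qed.

Lemma polar_mderiv F x c : F \is 3.-homog ->
  polar F x x c = 2 * \sum_i c 0 i * F^`M(i).@[x 0].
Proof.
elim/homog3_ind => [|y i j k F' IHF'].
  by rewrite polar0 big1 ?mulr0 // => i _; rewrite mderiv0 meval0 mulr0.
rewrite polarZD IHF' polarXXX.
have derX l m : ('X_l : {mpoly C[n]})^`M(m).@[x 0] = (l == m)%:R.
  rewrite mderivX mnm1E mevalZ mevalX; case: eqP => [->|_]; last by rewrite mul0r.
  by rewrite big1 ?mulr1 // => ? _; rewrite mnmBE subnn.
have pick l : \sum_m c 0 m * (l == m)%:R = c 0 l.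
  rewrite (bigD1 l) //= eqxx mulr1 big1 ?addr0 // => m ml.
  by rewrite eq_sym (negPf ml) mulr0.
have -> : \sum_m c 0 m * (y *: ('X_i * 'X_j * 'X_k) + F')^`M(m).@[x 0] =
   y * (x 0 j * x 0 k * (\sum_m c 0 m * (i == m)%:R)
      + x 0 i * x 0 k * (\sum_m c 0 m * (j == m)%:R)
      + x 0 i * x 0 j * (\sum_m c 0 m * (k == m)%:R))
   + \sum_m c 0 m * F'^`M(m).@[x 0].
  rewrite !mulr_sumr -!big_split /= mulr_sumr -big_split /=.
  apply: eq_bigr => m _.
  rewrite mderivD mderivZ !mderivM !(mevalD, mevalZ, mevalM) !derX !mevalXU.
  by ring.
by rewrite !pick; ring.
Qed.

(** On basis vectors the polar form is [N] times the coefficient, where [N] counts the permutations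
    of the three positions that preserve [(i, j, k)]; it is nonzero in characteristic zero. *)
Lemma mcoeff_polar F i j k : F \is 3.-homog ->
  polar F (delta_mx 0 i) (delta_mx 0 j) (delta_mx 0 k) = 0 ->
  F@_(U_(i) + U_(j) + U_(k))%MM = 0.
Proof.
move=> hF; set m := (_ + _)%MM.
pose N : C := polar 'X_[m] (delta_mx 0 i) (delta_mx 0 j) (delta_mx 0 k).
have N0 : N != 0.
  rewrite /N /m !mpolyXD polarXXX !mxE !eqxx !mulr1 -!addrA.
  by rewrite gt_eqF // ltr_pwDl // !addr_ge0 // !mulr_ge0 // ler0n.
suff -> : polar F (delta_mx 0 i) (delta_mx 0 j) (delta_mx 0 k) = N * F@_m.
  by move/eqP; rewrite mulf_eq0 (negPf N0) => /eqP.
elim/homog3_ind: hF => [|y a b c F' IHF']; first by rewrite polar0 mcoeff0 mulr0.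
rewrite polarZD IHF' mcoeffD mcoeffZ -!mpolyXD mcoeffX [N * (_ + _)]mulrDr.
congr (_ + _).
have [->|neq] := eqVneq; first by rewrite mulr1 mulrC.
rewrite !mulr0 !mpolyXD polarXXX !mxE !eqxx /=.
rewrite -!natrM !mulnb -!natrD.
have ne (i' j' k' : 'I_n) : (U_(i') + U_(j') + U_(k') = m)%MM ->
    (a == i') && (b == j') && (c == k') = false.
  by move=> mE; apply: contraNF neq => /andP[/andP[/eqP-> /eqP->] /eqP->]; apply/eqP.
by rewrite !ne ?mulr0 //; apply/mnmP => l; rewrite !mnmDE; lia.
Qed.

End CubicForms.

(** * From a Hessian of rank at most 2 to the S6 form *)

Section CubicFourfolds.
Variable C : numFieldType.
Implicit Types (F : {mpoly C[6]}) (g : 'M[C]_6).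

Lemma meval_lin_subst g F (x : 'rV[C]_6) :
  (lin_subst g F).@[x 0] = F.@[(x *m g^T) 0].
Proof.
rewrite /lin_subst comp_mpoly_meval; apply: mpoly.meval_eq => i.
rewrite tnth_mktuple raddf_sum /= mxE; apply: eq_bigr => j _.
by rewrite mevalZ mevalXU mxE mulrC.
Qed.

Lemma polar_lin_subst g F (a b c : 'rV[C]_6) :
  polar (lin_subst g F) a b c = polar F (a *m g^T) (b *m g^T) (c *m g^T).
Proof. by rewrite /polar !meval_lin_subst !mulmxDl. Qed.

Lemma lin_subst_homog3 g F : F \is 3.-homog -> lin_subst g F \is 3.-homog.
Proof.
have lin i : (\sum_(j < 6) g i j *: 'X_j : {mpoly C[6]}) \is 1.-homog.
  by apply: rpred_sum => j _; rewrite dhomogZ // dhomogX /= mdeg1.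
rewrite /lin_subst; elim/homog3_ind => [|z i j k F' IHF'].
  by rewrite comp_mpoly0 dhomog0.
rewrite comp_mpolyD comp_mpolyZ dhomogD // dhomogZ // !rmorphM /= !comp_mpolyXU.
rewrite -!tnth_nth !tnth_mktuple.
by apply: (@dhomogM _ _ mdeg 2 _ 1) => //; apply: (@dhomogM _ _ mdeg 1 _ 1).
Qed.

Lemma big_ord6 (T : Type) (idx : T) (op : Monoid.law idx) (f : 'I_6 -> T) :
  \big[op/idx]_(i < 6) f i =
    op (f 0) (op (f 1) (op (f 2) (op (f 3) (op (f 4) (f 5))))).
Proof.
rewrite !big_ord_recl big_ord0 Monoid.mulm1.
by do ?[congr (op _ _)]; congr f; apply: val_inj.
Qed.

(** Positive weight means that twice the exponent of [x_0] exceeds those of [x_4] and [x_5]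
    together. Then [x_0] occurs; if it occurs only once, at most one of the other two factors is
    [x_4] or [x_5], so one is among [x_1], [x_2], [x_3]. *)
Lemma S6_weight_gt0P (m : 'X_{1..6}) : mdeg m = 3%N ->
    ~~ (\sum_(i < 6) (m i)%:Z * S6_weights`_i <= 0) ->
  exists i j : 'I_6, (i < 4)%N /\ m = (U_(0%R) + U_(i) + U_(j))%MM.
Proof.
move=> m3; rewrite big_ord6 /= -ltNge => wt.
have md : (m 0%R + (m 1%R + (m 2%R + (m 3%R + (m 4%R + m 5%R)))) = 3)%N.
  by move: m3; rewrite mdegE big_ord6.
suff [i [i4 le_m]] : exists i : 'I_6, (i < 4)%N /\ (U_(0%R) + U_(i) <= m)%MM.
  have : mdeg (m - (U_(0%R) + U_(i)))%MM == 1%N.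
    rewrite -(eqn_add2r (mdeg (U_(0%R) + U_(i))%MM)) -mdegD submK // m3.
    by rewrite mdegD !mdeg1.
  rewrite mdeg_eq1 => /existsP[j /eqP mE]; exists i, j; split=> //.
  by rewrite -mE addmC submK.
have le_m (i : 'I_6) : (i != 0) -> (0 < m 0%R)%N -> (0 < m i)%N ->
    (U_(0%R) + U_(i) <= m)%MM.
  move=> i0 m0 mi; apply/mnm_lepP => k; rewrite mnmDE !mnm1E.
  have [<-|k0] := eqVneq 0 k; first by rewrite (negPf i0).
  by have [<-|] := eqVneq i k.
have [m2|m2] := leqP 2 (m 0).
  exists 0; split=> //; apply/mnm_lepP => k; rewrite mnmDE !mnm1E.
  by have [<-|] := eqVneq 0 k.
have m0 : (0 < m 0%R)%N by lia.
have [m1|m1] := posnP (m 1); last by exists 1; split=> //; apply: le_m.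
have [m2'|m2'] := posnP (m 2); last by exists 2; split=> //; apply: le_m.
exists 3; split=> //; apply: le_m => //; lia.
Qed.

Lemma type_S6_of_polar F (v : 'I_6 -> 'rV[C]_6) : F \is 3.-homog ->
    (\matrix_i v i) \in unitmx ->
    (forall i j : 'I_6, (i < 4)%N -> polar F (v 0) (v i) (v j) = 0) ->
  type_S6 F.
Proof.
move=> hF vu v0; exists (\matrix_i v i)^T; first by rewrite unitmx_tr.
move=> m mF; have hF' := lin_subst_homog3 (\matrix_i v i)^T hF.
apply/negPn/negP => /(S6_weight_gt0P (dhomog_mf hF' mF))[i [j [i4 mE]]].
move: mF; rewrite mcoeff_msupp mE mcoeff_polar ?eqxx //.
by rewrite polar_lin_subst trmxK -!rowE !rowK v0.
Qed.

(** The differential of the affine chart [x_j = 1]: tangent vectors of the chart as vectors of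
    [C^6]. *)
Definition chart_incl (j : 'I_6) (y : 'rV[C]_5) : 'rV[C]_6 :=
  \row_i (if unlift j i is Some k then y 0 k else 0).

Lemma chart_inclD j (y z : 'rV[C]_5) :
  chart_incl j (y + z) = chart_incl j y + chart_incl j z.
Proof. by apply/rowP => i; rewrite !mxE; case: unlift => [k|]; rewrite ?mxE ?addr0. Qed.

Lemma chart_inclZ j (s : C) (y : 'rV[C]_5) :
  chart_incl j (s *: y) = s *: chart_incl j y.
Proof. by apply/rowP => i; rewrite !mxE; case: unlift => [k|]; rewrite ?mxE ?mulr0. Qed.

Lemma chart_incl0 j : chart_incl j 0 = 0.
Proof. by apply/rowP => i; rewrite !mxE; case: unlift => [k|]; rewrite ?mxE. Qed.

Lemma chart_incl_sum j (I : finType) (z : I -> C) (y : I -> 'rV[C]_5) :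
  chart_incl j (\sum_k z k *: y k) = \sum_k z k *: chart_incl j (y k).
Proof.
apply: (big_ind2 (fun u w => chart_incl j u = w)).
- exact: chart_incl0.
- by move=> x _ y' _ <- <-; rewrite chart_inclD.
- by move=> k _; rewrite chart_inclZ.
Qed.

Lemma chart_incl_lift j (y : 'rV[C]_5) k : chart_incl j y 0 (lift j k) = y 0 k.
Proof. by rewrite mxE liftK. Qed.

Lemma chart_incl_self j (y : 'rV[C]_5) : chart_incl j y 0 j = 0.
Proof. by rewrite mxE unlift_none. Qed.

Lemma local_equationE F (p : 'rV[C]_6) j (y : 'rV[C]_5) : p 0 j != 0 ->
  local_equation F p j y = F.@[((p 0 j)^-1 *: p + chart_incl j y) 0].
Proof.
move=> pj; rewrite /local_equation; apply: mpoly.meval_eq => i.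
rewrite !mxE; case: unliftP => [k ->|->]; first by rewrite mulrC.
by rewrite mulVf // addr0.
Qed.

(** By the definition of [polar], the second difference at [P] is the polar form at
    [(P, s a', s b')] plus values of the cubic form at multiples of [s]; these are of order
    [s ^+ 3]. *)
Lemma local_equation_diff2_cvg F (p : 'rV[C]_6) j (a b : 'rV[C]_5) :
    F \is 3.-homog -> p 0 j != 0 ->
  s ^- 2 * diff (s *: a) (diff (s *: b) (local_equation F p j)) 0
    @[s --> (0 : C)^'] -->
    polar F ((p 0 j)^-1 *: p) (chart_incl j a) (chart_incl j b).
Proof.
move=> hF pj; set P := (p 0 j)^-1 *: p.
set a' := chart_incl j a; set b' := chart_incl j b.
pose K := F.@[(a' + b') 0] - F.@[a' 0] - F.@[b' 0].
have eqn : \forall s \near (0 : C)^', polar F P a' b' + s * K =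
    s ^- 2 * diff (s *: a) (diff (s *: b) (local_equation F p j)) 0.
  near=> s; have s0 : s != 0 by near: s; exact: nbhs_dnbhs_neq.
  have -> : polar F P a' b' = s ^- 2 * polar F P (s *: a') (s *: b').
    by rewrite polarZr // polarZm //; field.
  have -> : s * K = s ^- 2 * (F.@[(s *: a' + s *: b') 0] - F.@[(s *: a') 0]
                              - F.@[(s *: b') 0]).
    by rewrite -scalerDr !meval_homog3Z // /K; field.
  rewrite /diff !add0r !local_equationE // !chart_inclD !chart_inclZ chart_incl0.
  by rewrite -/P -/a' -/b' addr0 /polar addrA; ring.
apply: cvg_trans (near_eq_cvg eqn) _.
have : polar F P a' b' + s * K @[s --> (0 : C)^'] --> polar F P a' b' + 0 * K.
  apply: cvgD; first exact: cvg_cst.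
  by apply: cvgM; [exact: cvg_within | exact: cvg_cst].
by rewrite mul0r addr0.
Unshelve. all: by end_near. Qed.

Lemma type_S6_of_singularity F : is_cubic_fourfold F ->
  has_singularity_deforming_to_E6t F -> type_S6 F.
Proof.
move=> [_ hF] [p [j [[_ _ dF0] pj hdef]]].
pose P := (p 0 j)^-1 *: p.
have Pj : P 0 j = 1 by rewrite mxE mulVf.
(* Vanishing of the first derivatives at [p] puts [P] itself in the radical of the form
   [polar F P]. *)
have polPP c : polar F P c P = 0.
  rewrite polarZr // polarC12 polarZm // polarC12 polarC23.
  by rewrite polar_mderiv // big1 ?mulr0 // => i _; rewrite dF0 mulr0.
pose A : 'M[C]_5 := \matrix_(i, k)
  polar F P (chart_incl j (delta_mx 0 i)) (chart_incl j (delta_mx 0 k)).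
have rkA : (\rank A <= 2)%N.
  apply: deforms_to_E6t_rank hdef _ => i k; rewrite mxE.
  exact: local_equation_diff2_cvg.
(* Left multiplication by [M] turns [A] into its row basis cut off at the rank, so the rows of [M]
   with index at least 2 annihilate [A]. *)
pose M := invmx (col_ebase A).
have Mu : M \in unitmx by rewrite unitmx_inv col_ebase_unit.
have MA (i : 'I_5) : (2 <= i)%N -> row i M *m A = 0.
  move=> i2; rewrite -row_mul -{1}(mulmx_ebase A) -mulmxA /M.
  rewrite (mulKmx (col_ebase_unit A)) row_mul [row i _](_ : _ = 0) ?mul0mx //.
  apply/rowP => k; rewrite !mxE [_ && _](_ : _ = false) //.
  by apply/andP => -[_]; rewrite ltnNge (leq_trans rkA i2).
have polM (i : 'I_5) y : (2 <= i)%N ->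
    polar F P (chart_incl j (row i M)) (chart_incl j y) = 0.
  move=> i2; rewrite [y]row_sum_delta chart_incl_sum polar_sumr // big1 // => k _.
  rewrite polarC23 [row i M]row_sum_delta chart_incl_sum polar_sumr //.
  rewrite [X in _ * X](_ : _ = (row i M *m A) 0 k); last first.
    by rewrite mxE; apply: eq_bigr => l _; rewrite [A l k]mxE polarC23.
  by rewrite MA // mxE mulr0.
(* The index shift [k + 2] is modulo 5: it sends 0, 1, 2 to the rows of [M] that
   lie in the radical. *)
pose v (i : 'I_6) : 'rV[C]_6 :=
  if unlift 0 i is Some k then chart_incl j (row (k + 2) M) else P.
have vP : v 0 = P by rewrite /v unlift_none.
have vlift k : v (lift 0 k) = chart_incl j (row (k + 2) M) by rewrite /v liftK.
apply: (@type_S6_of_polar _ v) => //.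
  (* Independence: the coordinate [j] is 1 on [P] and 0 on the chart vectors, so the coefficient of
     [P] vanishes first; invertibility of [M] then treats the others. *)
  rewrite -row_free_unit; apply: inj_row_free => x.
  rewrite mulmx_sum_row big_ord_recl rowK vP.
  under eq_bigr do rewrite rowK vlift.
  rewrite -chart_incl_sum => xE.
  have x0 : x 0 0 = 0.
    have /rowP/(_ j) := xE; rewrite mxE [(_ *: P) 0 j]mxE chart_incl_self Pj.
    by rewrite mulr1 addr0 [RHS]mxE.
  pose y : 'rV[C]_5 := \row_l x 0 (lift 0 (l - 2)).
  have yM : y *m M = 0.
    rewrite mulmx_sum_row (reindex_inj (addIr 2)) /=.
    under eq_bigr do rewrite mxE addrK.
    apply/rowP => l; have /rowP/(_ (lift j l)) := xE.
    by rewrite x0 scale0r add0r chart_incl_lift => ->; rewrite !mxE.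
  have y0 : y = 0 by rewrite -[y](mulmxK Mu) yM mul0mx.
  apply/rowP => i; rewrite [RHS]mxE.
  case: (unliftP 0 i) => [k ->|->//].
  by have /rowP/(_ (k + 2)) := y0; rewrite !mxE addrK.
move=> i k i4; rewrite vP.
case: (unliftP 0 i) i4 => [i' ->|->] i4; last by rewrite vP polarC23.
case: (unliftP 0 k) => [k' ->|->]; last by rewrite vP.
rewrite !vlift polM //.
by case: i' i4 => -[|[|[|]]].
Qed.

End CubicFourfolds.

(** * Linear substitutions and the scaling of coefficients *)

Section LinearSubstitutions.
Variable C : numFieldType.
Implicit Types (F : {mpoly C[6]}) (g h : 'M[C]_6).

Lemma lin_subst_comp g h F :
  lin_subst h (lin_subst g F) = lin_subst (g *m h) F.
Proof.
rewrite /lin_subst [F \mPo [tuple \sum_(j < 6) g i j *: _ | i < 6]]comp_mpolyEX.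
rewrite raddf_sum [RHS]comp_mpolyEX; apply: eq_bigr => m _ /=.
rewrite comp_mpolyZ !comp_mpolyX rmorph_prod /=; congr (_ *: _).
apply: eq_bigr => i _; rewrite rmorphXn /= !tnth_mktuple; congr (_ ^+ _).
rewrite raddf_sum /=.
under eq_bigr do rewrite comp_mpolyZ comp_mpolyXU -tnth_nth tnth_mktuple scaler_sumr.
rewrite exchange_big /=; apply: eq_bigr => k _; rewrite mxE scaler_suml.
by apply: eq_bigr => j _; rewrite scalerA.
Qed.

Lemma lin_subst1 F : lin_subst 1%:M F = F.
Proof.
rewrite -[RHS]comp_mpoly_id /lin_subst; congr comp_mpoly.
apply: eq_mktuple => i; rewrite (bigD1 i) //= mxE eqxx scale1r big1 ?addr0 //.
by move=> j ji; rewrite mxE eq_sym (negPf ji) scale0r.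
Qed.

Lemma lin_substZ g (c : C) F : lin_subst g (c *: F) = c *: lin_subst g F.
Proof. exact: comp_mpolyZ. Qed.

(** Describes diagonal substitutions on coefficients and still makes sense for the limit at [s = 0],
    where the matrix of the subgroup degenerates. *)
Definition coef_scale (w : 'X_{1..6} -> C) F : {mpoly C[6]} :=
  \sum_(m <- msupp F) (F@_m * w m) *: 'X_[m].

Lemma mcoeff_coef_scale w F m : (coef_scale w F)@_m = F@_m * w m.
Proof.
rewrite /coef_scale raddf_sum /=.
have [mF|mF] := boolP (m \in msupp F).
  rewrite (bigD1_seq m) //= mcoeffZ mcoeffX eqxx mulr1 big1 ?addr0 // => m' m'm.
  by rewrite mcoeffZ mcoeffX (negPf m'm) mulr0.
rewrite (memN_msupp_eq0 mF) mul0r big_seq big1 // => m' m'F.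
rewrite mcoeffZ mcoeffX; case: eqP m'F => [->|_ _]; last by rewrite mulr0.
by rewrite (negPf mF).
Qed.

Lemma coef_scale_homog3 w F : F \is 3.-homog -> coef_scale w F \is 3.-homog.
Proof.
move=> /dhomogP hF; apply/dhomogP => m; rewrite mcoeff_msupp mcoeff_coef_scale.
by rewrite mulf_eq0 negb_or -mcoeff_msupp => /andP[/hF].
Qed.

Lemma lin_subst_diag (d : 'rV[C]_6) F :
  lin_subst (diag_mx d) F = coef_scale (fun m => \prod_i d 0 i ^+ m i) F.
Proof.
rewrite /lin_subst comp_mpolyEX; apply: eq_bigr => m _.
rewrite -scalerA comp_mpolyX; congr (_ *: _).
transitivity (\prod_(i < 6) (d 0 i *: 'X_i : {mpoly C[6]}) ^+ m i).
  apply: eq_bigr => i _; rewrite tnth_mktuple; congr (_ ^+ _).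
  rewrite (bigD1 i) //= mxE eqxx mulr1n big1 ?addr0 // => j ji.
  by rewrite mxE eq_sym (negPf ji) mulr0n scale0r.
under [LHS]eq_bigr do rewrite -mul_mpolyC exprMn -rmorphXn.
by rewrite big_split /= -rmorph_prod -mpolyXE_id -mul_mpolyC.
Qed.

End LinearSubstitutions.

(** * Degeneration along the S6 one-parameter subgroup *)

Section Instability.
Variable C : numFieldType.
Implicit Types (F : {mpoly C[6]}) (g h : 'M[C]_6).

(** Algebraic substitute for the limit [s -> 0]: if [p - c] were nonzero, the positive integers
    would give it more roots than its degree allows. *)
Lemma horner0_eq (p : {poly C}) (c : C) :
  (forall s, s != 0 -> p.[s] = c) -> p.[0] = c.
Proof.
move=> pc; suff : p - c%:P = 0.
  by move/eqP; rewrite subr_eq0 => /eqP ->; rewrite hornerC.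
apply/eqP; apply: contraT => nz.
pose rs := [seq i.+1%:R : C | i <- iota 0 (size (p - c%:P))].
have rs_uniq : uniq rs.
  by rewrite map_inj_uniq ?iota_uniq // => i j /eqP; rewrite eqr_nat eqSS => /eqP.
have rs_root : all (root (p - c%:P)) rs.
  apply/allP => _ /mapP[i _ ->].
  by rewrite /root !hornerE pc ?subrr ?pnatr_eq0.
by have := max_poly_roots nz rs_root rs_uniq; rewrite size_map size_iota ltnn.
Qed.

Lemma meval_horner k (Q : {mpoly C[k]}) (v : 'I_k -> {poly C}) (s : C) :
  Q.@[fun i => (v i).[s]] = (mmap polyC v Q).[s].
Proof.
rewrite mevalE /mmap horner_sum; apply: eq_bigr => m _.
rewrite hornerM hornerC /mmap1 horner_prod; congr (_ * _).
by apply: eq_bigr => i _; rewrite horner_exp.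
Qed.

(* Minus the S6-weight of [m]; the subtraction is exact when that weight is
   nonpositive. *)
Definition S6_coweight (m : 'X_{1..6}) : nat := (m 4%R + m 5%R - 2 * m 0%R)%N.

(** The parameter is inverted, with exponents [(-2, 0, 0, 0, 1, 1)], so that monomials of
    nonpositive S6-weight are multiplied by nonnegative powers of [s]. *)
Definition S6_subgroup (s : C) : 'M[C]_6 :=
  diag_mx (\row_i [:: s ^- 2; 1; 1; 1; s; s]`_i).

(** On S6-supported forms this extends the action of the subgroup to [s = 0], where exactly the
    monomials of weight zero survive, by [0 ^+ 0 = 1]. *)
Definition S6_twist (s : C) F := coef_scale (fun m => s ^+ S6_coweight m) F.

Lemma det_S6_subgroup s : s != 0 -> \det (S6_subgroup s) = 1.
Proof. by move=> s0; rewrite det_diag big_ord6 !mxE /=; field. Qed.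

Definition S6_supported F := forall m, m \in msupp F ->
  \sum_(i < 6) (m i)%:Z * S6_weights`_i <= 0.

Lemma lin_subst_S6_subgroup s F : S6_supported F -> s != 0 ->
  lin_subst (S6_subgroup s) F = S6_twist s F.
Proof.
move=> FS s0; rewrite lin_subst_diag; apply/mpolyP => m.
rewrite !mcoeff_coef_scale.
have [mF|mF] := boolP (m \in msupp F); last by rewrite (memN_msupp_eq0 mF) !mul0r.
congr (_ * _); have := FS m mF; rewrite !big_ord6 !mxE /= => wt.
have -> : s ^+ S6_coweight m = s ^+ (m 4 + m 5) / s ^+ (2 * m 0).
  rewrite -expfB_cond ?(negPf s0) //= /S6_coweight; lia.
by rewrite !expr1n !mul1r exprVn -exprM exprD mulrC.
Qed.

Lemma S6_twist0_fixed s F : s != 0 -> S6_supported F ->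
  lin_subst (S6_subgroup s) (S6_twist 0 F) = S6_twist 0 F.
Proof.
move=> s0 FS; rewrite lin_subst_S6_subgroup //; last first.
  move=> m; rewrite mcoeff_msupp mcoeff_coef_scale mulf_eq0 negb_or.
  by rewrite -mcoeff_msupp => /andP[/FS].
by apply/mpolyP => m; rewrite !mcoeff_coef_scale -mulrA -exprMn mul0r.
Qed.

(** The coordinates of [S6_twist s F] are polynomials in [s], hence so is the value of [Q], and
    [horner0_eq] applies. *)
Lemma S6_twist_limit (Q : {mpoly C[cubic_dim]}) (c : C) F :
    (forall s, s != 0 -> Q.@[cubic_coord (S6_twist s F)] = c) ->
  Q.@[cubic_coord (S6_twist 0 F)] = c.
Proof.
pose v (i : 'I_cubic_dim) : {poly C} :=
  cubic_coord F i *: 'X^(S6_coweight (val (val (enum_val i : cubic_monomial)))).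
have QE s : Q.@[cubic_coord (S6_twist s F)] = (mmap polyC v Q).[s].
  rewrite -meval_horner; apply: mpoly.meval_eq => i.
  by rewrite /cubic_coord mcoeff_coef_scale !hornerE.
by move=> Qc; rewrite QE; apply: horner0_eq => s s0; rewrite -QE Qc.
Qed.

(** Rescaling [x_0] corrects the determinant and adds no monomial to the support. *)
Lemma type_S6_SL F : type_S6 F ->
  exists2 g : 'M[C]_6, \det g = 1 & S6_supported (lin_subst g F).
Proof.
move=> [g gu gS].
pose d : 'rV[C]_6 := \row_i if i == 0 then (\det g)^-1 else 1.
exists (g *m diag_mx d).
  rewrite det_mulmx det_diag big_ord6 !mxE /= !mulr1 mulfV //.
  by rewrite -unitfE -unitmxE.
rewrite -lin_subst_comp lin_subst_diag => m.
rewrite mcoeff_msupp mcoeff_coef_scale mulf_eq0 negb_or -mcoeff_msupp.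
by move=> /andP[/gS].
Qed.

Lemma type_S6_not_stable F : F \is 3.-homog -> type_S6 F -> ~ stable F.
Proof.
move=> hF /type_S6_SL[g g1 FS] [d [P [[_ _ Pinv] PF Pclosed stab_fin]]].
pose F1 := lin_subst g F; have hF1 : F1 \is 3.-homog by exact: lin_subst_homog3.
pose F0 := S6_twist 0 F1.
have PF0 : P.@[cubic_coord F0] = P.@[cubic_coord F].
  apply: S6_twist_limit => s s0; rewrite -lin_subst_S6_subgroup //.
  by rewrite Pinv ?det_S6_subgroup // Pinv.
have [h [c [h1 c0 F0E]]] : SL_orbit F F0.
  apply: (Pclosed F) => //; first exact: coef_scale_homog3.
    by rewrite PF0.
  (* The twists with nonzero [s] lie in the orbit of [F], so an equation of the orbit also holds at
     [F0]. *)
  move=> e Q _ QF; apply: S6_twist_limit => s s0; apply: QF.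
  exists (g *m S6_subgroup s), 1; rewrite det_mulmx g1 det_S6_subgroup // mulr1.
  by rewrite oner_neq0 scale1r -lin_subst_comp lin_subst_S6_subgroup.
have hu : h \in unitmx by rewrite unitmxE h1 unitr1.
(* Conjugation by [h] carries the stabilizer of [F0] to that of [F]. The parameters [k.+1] are
   nonzero and pairwise distinct in characteristic zero, and the entry [(4, 4)] of [S6_subgroup]
   recovers them. *)
pose f k := h *m S6_subgroup k.+1%:R *m invmx h.
have f_stab k : SL_stabilizer F (f k).
  have k0 : k.+1%:R != 0 :> C by rewrite pnatr_eq0.
  split; first by rewrite !det_mulmx det_inv h1 det_S6_subgroup // invr1 !mulr1.
  exists 1; rewrite scale1r.
  have FE : lin_subst h F = c^-1 *: F0 by rewrite F0E scalerK.
  rewrite /f -!lin_subst_comp FE lin_substZ S6_twist0_fixed // -FE.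
  by rewrite lin_subst_comp mulmxV // lin_subst1.
have f_inj : injective f.
  move=> k l /(congr1 (fun M => invmx h *m M *m h)).
  rewrite /f !mulmxA !(mulVmx hu) !mul1mx -!mulmxA !(mulVmx hu) !mulmx1.
  move=> /matrixP/(_ 4 4); rewrite !mxE /= !mulr1n => /eqP.
  by rewrite eqr_nat eqSS => /eqP.
have /finite_seqP[s sE] := stab_fin.
have fs k : f k \in s.
  by have := f_stab k; rewrite sE.
have uf : uniq [seq f k | k <- iota 0 (size s).+1].
  by rewrite map_inj_uniq ?iota_uniq.
have sub : {subset [seq f k | k <- iota 0 (size s).+1] <= s}.
  by move=> _ /mapP[k _ ->].
by have := uniq_leq_size uf sub; rewrite size_map size_iota ltnn.
Qed.

End Instability.

Theorem lemma5p4 (R : realType) (F : {mpoly R[i][6]}) :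
  is_cubic_fourfold F ->
  has_singularity_deforming_to_E6t F ->
  type_S6 F /\ ~ stable F.
Proof.
move=> hF sF; have S6 := type_S6_of_singularity hF sF.
by split=> //; apply: type_S6_not_stable => //; case: hF.
Qed.
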